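(* Let $p$ be a prime and let $\psi(X)\in\mathbb{F}_p(X)$ be a rational function of degree $d\ge 2$. Then for any positive integer $$H\le p^{1/(2d^2+d-1/2)},$$ uniformly over arbitrary intervals $\mathcal{I}=[K,K+H]$ and $\mathcal{J}=[L,L+H]$, we have $$\#\left(\psi(\mathcal{I})\cap\mathcal{J}\right)\le H^{1/d+o(1)}.$$
   Context: $\mathbb{F}_p$ is the finite field of $p$ elements, represented by the integers $\{0,1,\ldots,p-1\}$. An interval $[K,K+H]$ (with $K$ an integer) is viewed as a subset of $\mathbb{F}_p$, namely the set of residue classes modulo $p$ of the integers $K,K+1,\ldots,K+H$. A rational function is written in lowest terms $\psi=f/g$ with coprime $f,g\in\mathbb{F}_p[X]$, and its degree is $\max\{\deg f,\deg g\}$. For a set $\mathcal{A}\subset\mathbb{F}_p$, $$\psi(\mathcal{A})=\{\psi(x) : x\in\mathcal{A},\ g(x)\ne 0\}.$$ The term $o(1)$ denotes a quantity that tends to $0$ as $H\to\infty$ for fixed $d$, uniformly in $p$, in $\psi$ of degree $d$, and in the intervals $\mathcal{I},\mathcal{J}$ (subject to the stated restriction on $H$).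
   Formalization: The bound is stated for integers H ≥ 2 rather than all positive H, since for H = 1 the right side equals 1 whatever o(1) is, and the claim fails (ψ = X², I = J = [0,1] gives 2 elements). *)

(* Defs.v *)
From HB Require Import structures.
From mathcomp Require Import all_boot all_order all_algebra fraction.

Set Implicit Arguments.
Unset Strict Implicit.
Unset Printing Implicit Defensive.

Import Order.TTheory GRing.Theory Num.Theory.

Local Open Scope ring_scope.

Section RationalFunctions.
Variable F : fieldType.
Implicit Types (psi : {fraction {poly F}}) (x : F).

(* The representative of a fraction chosen by the library need not be reduced,
   so the common factor is divided out.  The result is unique only up to a
   nonzero scalar common to numerator and denominator, which affects neither
   degrees nor values. *)
Definition rnum psi : {poly F} :=
  \n_(repr psi) %/ gcdp \n_(repr psi) \d_(repr psi).

Definition rden psi : {poly F} :=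
  \d_(repr psi) %/ gcdp \n_(repr psi) \d_(repr psi).

Definition rdeg psi : nat := maxn (size (rnum psi)).-1 (size (rden psi)).-1.

(* Meaningful only when the denominator does not vanish at x. *)
Definition reval psi x : F := (rnum psi).[x] / (rden psi).[x].

Lemma rden_neq0 psi : rden psi != 0.
Proof.
have d0 : \d_(repr psi) != 0 by exact: denom_ratioP.
by rewrite /rden dvdp_div_eq0 // dvdp_gcdr.
Qed.

Lemma coprimep_rnum_rden psi : coprimep (rnum psi) (rden psi).
Proof. by apply: coprimep_div_gcd; rewrite denom_ratioP orbT. Qed.

Lemma rnum_rdenE psi :
  psi = FracField.tofrac (rnum psi) / FracField.tofrac (rden psi).
Proof.
have e0 : FracField.tofrac (rden psi) != 0 by rewrite tofrac_eq0 rden_neq0.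
apply: (mulIf e0); rewrite divfK //.
rewrite -{1}[psi]reprK /FracField.tofrac; unlock.
rewrite -[LHS]FracField.pi_mul; apply/eqmodP.
rewrite /= FracField.equivfE /FracField.mulf.
rewrite !numden_Ratio ?oner_eq0 ?mulr1 ?denom_ratioP //.
set n := \n_(repr psi); set m := \d_(repr psi).
have dn : gcdp n m %| n by exact: dvdp_gcdl.
have dm : gcdp n m %| m by exact: dvdp_gcdr.
by rewrite /rden /rnum -/n -/m divp_mulA // divp_mulA // mulrC.
Qed.

End RationalFunctions.

Definition rimage (F : finFieldType) (psi : {fraction {poly F}})
    (A : {set F}) : {set F} :=
  [set reval psi x | x in A & (rden psi).[x] != 0].

(* The classes modulo p of K, K + 1, ..., K + H. *)
Definition interval_mod (p : nat) (K : int) (H : nat) : {set 'F_p} :=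
  [set (K + i%:Z)%:~R | i : 'I_H.+1].

(* Main.v *)
Require Import Defs.
From HB Require Import structures.
From mathcomp Require Import all_boot all_order all_algebra all_fingroup.
From mathcomp Require Import fraction zify ring lra.
From mathcomp Require Import all_classical all_reals all_analysis.

(** After translating both intervals to [0, H], the points to count are the
    pairs of integers (x, y) in the box [0, H]^2 with F(x) = y G(x) modulo p,
    where F and G are coprime and the larger of their degrees is d.

    Lifting.  The 2d + 2 monomials x^i y^j, with i <= d and j <= 1, are linearly
    dependent modulo p on these points, so every square minor of order 2d + 2
    of the matrix of their values is divisible by p.  Such a minor is at most
    (2d + 2)! H^((d + 1)^2), and the exponent in the restriction on H exceeds
    (d + 1)^2 by at least 1/2 when d >= 2; so for large H all these minors
    vanish.  Hence ([integer_lift]) all the points lie on one curve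
    f(x) = y g(x) with f and g integer polynomials of degree at most d, whose
    coefficients are bounded by a fixed power of H.

    Determinant method.  Let q = l^k be a prime power and consider n = (m + 1) d
    of the points, with abscissae congruent modulo q.  Let D be the determinant
    of the n monomials x^a y^b, with a < d and b <= m, at these points.
    Multiplying the row of a point by g(x)^m turns its entries into values at x
    of polynomials of degree less than n, namely X^a f^b g^(m - b), so
      D * prod g(x_i)^m = Vandermonde(x_i) * (integer)
    ([det_monomial_mx]), and the Vandermonde determinant is divisible by
    q^(n (n - 1) / 2).  If l^w divides no g(x_i) with l^w much smaller than q,
    then D itself is divisible by nearly the same power of q.  On the other hand
    |D| <= n! H^(n (d - 1 + m) / 2), and D is nonzero because it is nonzero
    modulo p: this is where coprimality of F and G is used
    ([det_monomial_mx_neq0]).  So q is at most about H^(1/d) for m large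
    ([class_bound]).  Therefore, if q is a little larger than H^(1/d), each
    class modulo q contains boundedly many points.

    The prime l cannot be fixed beforehand, as l^w may divide g(x) for many x.
    But a nonzero g(x) is at most a power of H, so if l runs through sufficiently
    many primes, a number depending only on d and epsilon, every x with
    g(x) <> 0 is admissible for one of them ([card_points]); at most d values
    of x have g(x) = 0.  This gives O(H^(1/d + epsilon)) for every epsilon > 0,
    and [exponent_sequence] turns these bounds into a single exponent
    1/d + o(1). *)

Set Implicit Arguments.
Unset Strict Implicit.
Unset Printing Implicit Defensive.

Import Order.TTheory GRing.Theory Num.Theory.
Import numFieldNormedType.Exports.

Local Open Scope ring_scope.

(** * Determinants and small kernel vectors *)

Lemma leq_expn2r (u v e : nat) : (u <= v)%N -> (u ^ e <= v ^ e)%N.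
Proof. by case: e => // e uv; rewrite leq_exp2r. Qed.

Lemma det_le (R : numDomainType) (n : nat) (A : 'M[R]_n) (c : 'I_n -> R) :
  (forall i j, `|A i j| <= c j) -> `|\det A| <= n`!%:R * \prod_j c j.
Proof.
move=> Ac; apply: (le_trans (ler_norm_sum _ _ _)).
rewrite -card_Sn mulr_natl -sumr_const; apply: ler_sum => s _.
rewrite normrM normrX normrN1 expr1n mul1r normr_prod.
rewrite [leRHS](reindex_inj (@perm_inj _ s)) /=.
by apply: ler_prod => i _; rewrite normr_ge0 Ac.
Qed.

(** A form of Siegel's lemma.  Take r such that some minor of order r does not
    vanish, on rows f and distinct columns g say, while all those of order
    r + 1 do, and a further column s.
    Adjoining any row x gives a vanishing minor of order r + 1; its expansion
    along the row x is a linear relation whose coefficients do not depend on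
    x, the coefficient of column s being the chosen minor up to sign. *)
Lemma small_kernel (R : numDomainType) (T : Type) (k : nat)
    (M : T -> 'I_k -> R) (B : R) :
    1 <= B -> (forall x j, `|M x j| <= B) ->
    (forall f : 'I_k -> T, \det (\matrix_(i, j) M (f i) j) = 0) ->
  exists c : 'I_k -> R, [/\ exists j, c j != 0,
    forall j, `|c j| <= k`!%:R * B ^+ k
    & forall x, \sum_j c j * M x j = 0].
Proof.
move=> B1 MB det0.
have B0 : 0 <= B by apply: le_trans B1.
pose P r := exists (f : 'I_r -> T) (g : 'I_r -> 'I_k),
  injective g /\ \det (\matrix_(i, j) M (f i) (g j)) != 0.
have P0 : P 0%N.
  have f0 (U : Type) : 'I_0 -> U by case.
  by exists (f0 T), (f0 'I_k); rewrite det_mx00 oner_eq0; split=> // -[].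
have nPk : ~ P k.
  case=> f [g [gI]]; case/negP; apply/eqP.
  have -> : \matrix_(i, j) M (f i) (g j)
     = col_perm (perm gI) (\matrix_(i, j) M (f i) j).
    by apply/matrixP=> i j; rewrite !mxE permE.
  by rewrite col_permE det_mulmx det0 mul0r.
have [r [[f [g [gI Drg]]] nPr]] : exists r, P r /\ ~ P r.+1.
  case: (pselect (exists r, P r /\ ~ P r.+1)) => // nP.
  case: nPk; elim: {det0 MB M} k P P0 nP => // k0 IH P P0 nP.
  apply: (IH (fun r => P r.+1)) => [|[r nPr]]; last by apply: nP; exists r.+1.
  by apply: contrapT => nP1; apply: nP; exists 0%N.
have rk : (r < k)%N.
  have := leq_card g gI; rewrite !card_ord leq_eqVlt => /orP[/eqP rk|//].
  by case: nPk; rewrite -rk; exists f, g.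
have [s sg] : exists s, s \notin codom g.
  apply/existsP; rewrite -negb_forall; apply: contraL rk => /forallP gs.
  rewrite -leqNgt -{1}(card_ord k) -(card_ord r) -(card_codom gI).
  by apply: subset_leq_card; apply/fintype.subsetP=> s _; apply: gs.
(* The columns of g, followed by s in last position. *)
pose g' (j : 'I_r.+1) := if unlift ord_max j is Some j' then g j' else s.
have g'I : injective g'.
  move=> i j; rewrite /g'; case: unliftP => [i'|] ->; case: unliftP => [j'|] ->//.
  - by move/gI->.
  - by move=> e; case/negP: sg; rewrite -e codom_f.
  - by move=> e; case/negP: sg; rewrite e codom_f.
pose cof (j : 'I_r.+1) := (-1) ^+ (@ord_max r + j) *
  \det (\matrix_(i, j') M (f i) (g' (lift j j'))).
have rel x : \sum_j M x (g' j) * cof j = 0.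
  pose f' (i : 'I_r.+1) := if unlift ord_max i is Some i' then f i' else x.
  have : \det (\matrix_(i, j) M (f' i) (g' j)) = 0.
    by apply/eqP/negP => /negP D; apply: nPr; exists f', g'.
  rewrite (expand_det_row _ ord_max) => D0; rewrite -[RHS]D0.
  apply: eq_bigr => j _.
  rewrite !mxE {1}/f' unlift_none; congr (_ * _); congr (_ * \det _).
  by apply/matrixP=> i j'; rewrite !mxE /f' liftK.
have cofB j : `|cof j| <= r`!%:R * B ^+ r.
  rewrite /cof normrM normrX normrN1 expr1n mul1r.
  apply: (le_trans (det_le (c := fun=> B) _)) => [i j'|]; first by rewrite mxE.
  by rewrite prodr_const card_ord.
exists (fun t => \sum_(j | g' j == t) cof j); split.
- exists s; rewrite (big_pred1 ord_max) => [|j /=]; last first.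
    by rewrite -(_ : g' ord_max = s) ?(inj_eq g'I) // /g' unlift_none.
  rewrite mulf_neq0 ?signr_eq0 //.
  apply: contra_neq Drg => <-; congr (\det _); apply/matrixP=> i j.
  by rewrite !mxE /g' liftK.
- move=> t; apply: (le_trans (ler_norm_sum _ _ _)).
  apply: (@le_trans _ _ (\sum_(j < r.+1) r`!%:R * B ^+ r)).
    rewrite [leRHS](bigID (fun j => g' j == t)) /= ler_wpDr //.
      by apply: sumr_ge0 => i _; rewrite mulr_ge0 ?ler0n ?exprn_ge0.
    exact: ler_sum.
  rewrite sumr_const card_ord -mulrnAl -mulrnA mulnC -factS.
  by rewrite ler_pM ?ler0n ?exprn_ge0 ?ler_nat ?leq_fact ?ler_weXn2l // ltnW.
- move=> x; rewrite -[RHS](rel x).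
  rewrite (partition_big g' xpredT) //=; apply: eq_bigr => t _.
  by rewrite mulr_suml; apply: eq_bigr => j /eqP <-; rewrite mulrC.
Qed.

(** * Monomial determinants on the curve f(x) = y g(x) *)

(** The monomials x^a y^b with a < d are numbered by j = b d + a, so that the
    first (m + 1) d of them are those with b <= m. *)
Definition monomial_mx (R : comNzRingType) (d n : nat) (x y : 'I_n -> R) :
    'M[R]_n :=
  \matrix_(i, j) (x i ^+ (j %% d) * y i ^+ (j %/ d)).

(** The monomial of index j on the curve y = f / g, multiplied by g^m. *)
Definition cleared_monomial (R : comNzRingType) (d m : nat) (f g : {poly R})
    (j : nat) : {poly R} :=
  'X^(j %% d) * f ^+ (j %/ d) * g ^+ (m - j %/ d).

(** The matrix of values is the transposed Vandermonde matrix times the matrix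
    of coefficients. *)
Lemma det_horner (R : comNzRingType) (n : nat) (P : 'I_n -> {poly R})
    (x : 'I_n -> R) :
    (forall j, (size (P j) <= n)%N) ->
  \det (\matrix_(i, j) (P j).[x i]) =
    (\prod_(i < n) \prod_(j < n | (i < j)%N) (x j - x i)) *
    \det (\matrix_(k, j) (P j)`_k).
Proof.
move=> sP.
have -> : \prod_(i < n) \prod_(j < n | (i < j)%N) (x j - x i)
    = \det (Vandermonde n (\row_i x i)).
  rewrite det_Vandermonde; apply: eq_bigr => i _.
  by apply: eq_bigr => j _; rewrite !mxE.
rewrite -[\det (Vandermonde _ _)]det_tr -det_mulmx.
congr (\det _); apply/matrixP => i j.
rewrite !mxE (horner_coef_wide _ (sP j)); apply: eq_bigr => k _.
by rewrite !mxE mulrC.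
Qed.

Lemma size_cleared_monomial (R : comNzRingType) (d m : nat) (f g : {poly R})
    (j : nat) :
    (0 < d)%N -> (j < m.+1 * d)%N ->
    (size f <= d.+1)%N -> (size g <= d.+1)%N ->
  (size (cleared_monomial d m f g j) <= m.+1 * d)%N.
Proof.
move=> d0 jn sf sg; rewrite /cleared_monomial.
have jd := ltn_pmod j d0.
have jm : (j %/ d <= m)%N by rewrite -ltnS ltn_divLR.
have s1 := size_polyMleq ('X^(j %% d) * f ^+ (j %/ d)) (g ^+ (m - j %/ d)).
have s2 := size_polyMleq ('X^(j %% d)) (f ^+ (j %/ d)).
have sX := size_polyXn R (j %% d).
have s3 := size_poly_exp_leq f (j %/ d).
have s4 := size_poly_exp_leq g (m - j %/ d).
have e3 : ((size f).-1 * (j %/ d) <= d * (j %/ d))%N.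
  by rewrite leq_mul2r; apply/orP; right; lia.
have e4 : ((size g).-1 * (m - j %/ d) <= d * (m - j %/ d))%N.
  by rewrite leq_mul2r; apply/orP; right; lia.
have e5 : (d * (j %/ d) + d * (m - j %/ d) = d * m)%N.
  by rewrite -mulnDr subnKC.
by rewrite mulSn (mulnC m); lia.
Qed.

Lemma horner_cleared_monomial (R : comNzRingType) (d m : nat) (f g : {poly R})
    (j : nat) (x y : R) :
    (0 < d)%N -> (j < m.+1 * d)%N -> f.[x] = y * g.[x] ->
  (cleared_monomial d m f g j).[x] = x ^+ (j %% d) * y ^+ (j %/ d) * g.[x] ^+ m.
Proof.
move=> d0 jn e; have jm : (j %/ d <= m)%N by rewrite -ltnS ltn_divLR.
rewrite /cleared_monomial !hornerM !horner_exp hornerX e exprMn.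
rewrite -[in RHS](subnKC jm) exprD.
by rewrite !mulrA.
Qed.

(** The identity behind the determinant method: scaling row i by g(x_i)^m makes
    the entries polynomials of degree less than (m + 1) d in x_i alone. *)
Lemma det_monomial_mx (R : comNzRingType) (d m : nat) (f g : {poly R})
    (x y : 'I_(m.+1 * d) -> R) :
    (0 < d)%N -> (size f <= d.+1)%N -> (size g <= d.+1)%N ->
    (forall i, f.[x i] = y i * g.[x i]) ->
  \det (monomial_mx d x y) * \prod_i g.[x i] ^+ m =
    (\prod_(i < m.+1 * d) \prod_(j < m.+1 * d | (i < j)%N) (x j - x i)) *
    \det (\matrix_(k, j < m.+1 * d) (cleared_monomial d m f g j)`_k).
Proof.
move=> d0 sf sg e.
rewrite -(@det_horner _ _ (fun j => cleared_monomial d m f g j)) => [|j]; last first.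
  exact: size_cleared_monomial.
have -> : \prod_i g.[x i] ^+ m = \det (diag_mx (\row_i g.[x i] ^+ m)).
  by rewrite det_diag; apply: eq_bigr => i _; rewrite mxE.
rewrite mulrC -det_mulmx; congr (\det _); apply/matrixP=> i j.
by rewrite mul_diag_mx !mxE (horner_cleared_monomial d0 (ltn_ord j) (e i)) mulrC.
Qed.

(** All terms but the last are divisible by g, so g divides c_m f^m, hence c_m;
    as c_m has smaller degree than g it vanishes, and one factor g cancels. *)
Lemma combination_eq0_l (F : fieldType) (d : nat) (f g : {poly F}) (m : nat)
    (c : nat -> {poly F}) :
    coprimep f g -> size g = d.+1 -> (forall b, size (c b) <= d)%N ->
    \sum_(b < m.+1) c b * f ^+ b * g ^+ (m - b) = 0 ->
  forall b, (b <= m)%N -> c b = 0.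
Proof.
move=> co sg sc; elim: m => [|m IH].
  rewrite big_ord1 !mulr1 => c0 b; by rewrite leqn0 => /eqP ->.
rewrite big_ord_recr /= subnn expr0 mulr1.
have -> : \sum_(i < m.+1) c i * f ^+ i * g ^+ (m.+1 - i)
   = (\sum_(i < m.+1) c i * f ^+ i * g ^+ (m - i)) * g.
  rewrite mulr_suml; apply: eq_bigr => i _.
  by rewrite subSn -1?ltnS // exprS -!mulrA (mulrC g).
move=> e.
have cm0 : c m.+1 = 0.
  apply: contraTeq (sc m.+1) => cN0; rewrite -ltnNge -sg.
  apply: dvdp_leq => //; rewrite -(@Gauss_dvdpl _ _ (f ^+ m.+1)); last first.
    by rewrite coprimep_sym coprimep_expl.
  move/eqP: e; rewrite addrC addr_eq0 => /eqP ->.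
  by rewrite dvdpNr dvdp_mull.
move: e; rewrite cm0 mul0r addr0 => /eqP; rewrite mulf_eq0.
have /negPf -> : g != 0 by rewrite -size_poly_eq0 sg.
rewrite orbF => /eqP /IH cb b; rewrite leq_eqVlt => /orP[/eqP -> //|].
by rewrite ltnS => /cb.
Qed.

(** If f is the one of degree d, reversing the order of the terms exchanges
    the roles of f and g. *)
Lemma combination_eq0 (F : fieldType) (d : nat) (f g : {poly F}) (m : nat)
    (c : nat -> {poly F}) :
    coprimep f g -> maxn (size f) (size g) = d.+1 ->
    (forall b, size (c b) <= d)%N ->
    \sum_(b < m.+1) c b * f ^+ b * g ^+ (m - b) = 0 ->
  forall b, (b <= m)%N -> c b = 0.
Proof.
move=> co; case: leqP => _ s sc e; first exact: combination_eq0_l co s sc e.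
move=> b bm; rewrite -(subKn bm); rewrite coprimep_sym in co.
apply: (combination_eq0_l (c := fun b => c (m - b)%N) co s _ _ (leq_subr _ _)) => //.
rewrite -[RHS]e [RHS](reindex_inj rev_ord_inj) /=; apply: eq_bigr => i _.
by rewrite subSS subKn -1?ltnS // mulrAC.
Qed.

(** A relation between the columns would be a polynomial of degree less than n
    with the n roots x_i, hence zero; [combination_eq0] then kills its
    coefficients. *)
Lemma det_monomial_mx_neq0 (F : fieldType) (d m : nat) (f g : {poly F})
    (x y : 'I_(m.+1 * d) -> F) :
    (0 < d)%N -> coprimep f g -> maxn (size f) (size g) = d.+1 ->
    injective x -> (forall i, f.[x i] = y i * g.[x i]) ->
  \det (monomial_mx d x y) != 0.
Proof.
move=> d0 co s xI e; set n := (m.+1 * d)%N in x y xI e *.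
rewrite -det_tr; apply/det0P => -[v vN0 vA]; case/negP: vN0; apply/eqP.
(* The relation between the columns, with denominators cleared. *)
pose P := \sum_(j < n) v 0 j *: cleared_monomial d m f g j.
have P0 : P = 0.
  apply/eqP; apply: contraT => PN0.
  have := max_poly_roots PN0 (rs := codom x); rewrite size_codom card_ord.
  have sP : (size P <= n)%N.
    apply: (leq_trans (size_sum _ _ _)); apply/bigmax_leqP => j _.
  apply: leq_trans (size_scale_leq _ _) _.
    by apply: size_cleared_monomial => //; rewrite -s ?leq_maxl ?leq_maxr.
  move=> H; have := leq_trans (H _ _) sP; rewrite ltnn; apply.
    apply/allP => _ /codomP[i ->]; rewrite /root /P horner_sum.
    move/rowP: vA => /(_ i); rewrite !mxE => vi.
    rewrite (eq_bigr (fun j => (v 0 j * (monomial_mx d x y)^T j i) * g.[x i] ^+ m)).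
      by rewrite -mulr_suml vi mul0r.
    move=> j _; rewrite hornerZ (horner_cleared_monomial d0 (ltn_ord j) (e i)).
    by rewrite !mxE !mulrA.
  by rewrite map_inj_uniq ?enum_uniq.
(* The coefficient of f^b g^(m - b) in P. *)
pose c (b : nat) := \sum_(j < n | (j %/ d)%N == b) v 0 j *: 'X^(j %% d).
have sc b : (size (c b) <= d)%N.
  apply: (leq_trans (size_sum _ _ _)); apply/bigmax_leqP => j _.
  apply: leq_trans (size_scale_leq _ _) _.
  by rewrite size_polyXn ltn_pmod.
have jm (j : 'I_n) : (j %/ d <= m)%N by rewrite -ltnS ltn_divLR.
have cP : \sum_(b < m.+1) c b * f ^+ b * g ^+ (m - b) = 0.
  rewrite -[RHS]P0 /P.
  rewrite (partition_big (fun j : 'I_n => inord (j %/ d) : 'I_m.+1) xpredT) //=.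
  apply: eq_bigr => b _; rewrite /c -mulrA mulr_suml; apply: eq_big => [j|j /eqP <-].
    by rewrite -val_eqE /= inordK // ltnS.
  by rewrite /cleared_monomial -!scalerAl !mulrA.
apply/rowP => j; rewrite mxE.
have /(congr1 (fun p : {poly F} => p`_(j %% d))) :=
  combination_eq0 co s sc cP (jm j).
rewrite coef0 coef_sum (bigD1 j) //= coefZ coefXn eqxx mulr1 big1 ?addr0 //.
move=> i /andP[/eqP ij iNj]; rewrite coefZ coefXn.
have [ji|_] := eqVneq (j %% d)%N (i %% d)%N; last exact: mulr0.
by case/eqP: iNj; apply: val_inj; rewrite /= (divn_eq i d) (divn_eq j d) ij ji.
Qed.

(** * Points in one residue class modulo a prime power *)

Lemma absz_prod (I : finType) (P : pred I) (F : I -> int) :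
  absz (\prod_(i | P i) F i) = (\prod_(i | P i) absz (F i))%N.
Proof. exact: (big_morph absz abszM absz1). Qed.

Lemma absz_det_le (n : nat) (A : 'M[int]_n) (c : 'I_n -> nat) :
    (forall i j, (absz (A i j) <= c j)%N) ->
  (absz (\det A)%R <= n`! * \prod_j c j)%N.
Proof.
move=> Ac; rewrite -lez_nat abszE PoszM -!natz natr_prod.
by apply: det_le => i j; rewrite natz -abszE lez_nat.
Qed.

Lemma dvdn_vandermonde (n : nat) (q : nat) (x : 'I_n -> int) :
    (forall i j, (q%:Z %| x j - x i)%Z) ->
  (q ^ 'C(n, 2) %|
    absz (\prod_(i < n) \prod_(j < n | (i < j)%N) (x j - x i))%R)%N.
Proof.
move=> qx.
have -> : (q ^ 'C(n, 2) = \prod_(i < n) \prod_(j < n | (i < j)%N) q)%N.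
  rewrite -bin2_sum big_mkord expn_sum.
  rewrite [RHS](exchange_big_dep xpredT) //=.
  apply: eq_bigr => j _.
  rewrite -(big_ord_widen _ (fun=> q)) ?(ltnW (ltn_ord j)) //.
  by rewrite prod_nat_const card_ord.
rewrite absz_prod; apply: (big_ind2 (fun a b => a %| b)%N) => //.
  by move=> a b c e ab ce; apply: dvdn_mul.
move=> i _; rewrite absz_prod; apply: (big_ind2 (fun a b => a %| b)%N) => //.
  by move=> a b c e ab ce; apply: dvdn_mul.
by move=> j _; have := qx i j; rewrite dvdzE.
Qed.

(** Reversing the order of the indices exchanges (a, b) and (d - 1 - a, m - b),
    so opposite monomials have total degree d - 1 + m together. *)
Lemma sum_monomial_degrees (d m : nat) : (0 < d)%N ->
  ((\sum_(j < m.+1 * d) (j %% d + j %/ d)).*2 = m.+1 * d * (d.-1 + m))%N.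
Proof.
move=> d0; rewrite -addnn [X in (_ + X)%N](reindex_inj rev_ord_inj) /=.
rewrite -big_split /= -[RHS]/(m.+1 * d * _)%N -[in RHS](card_ord (m.+1 * d)).
rewrite -sum_nat_const.
apply: eq_bigr => j _; have jn := ltn_ord j.
have jm : (j %/ d <= m)%N by rewrite -ltnS ltn_divLR.
have jd := ltn_pmod j d0.
have -> : (m.+1 * d - j.+1 = (m - j %/ d) * d + (d.-1 - j %% d))%N.
  have ej := divn_eq j d; rewrite mulnBl.
  have : (j %/ d * d <= m * d)%N by rewrite leq_mul2r jm orbT.
  lia.
have rd : (d.-1 - j %% d < d)%N by lia.
by rewrite modnMDl (modn_small rd) divnMDl // (divn_small rd); lia.
Qed.

Lemma det_monomial_mx_le (d n H : nat) (x y : 'I_n -> int) :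
    (forall i, absz (x i) <= H)%N -> (forall i, absz (y i) <= H)%N ->
  (absz (\det (monomial_mx d x y))%R <=
    n`! * H ^ (\sum_(j < n) (j %% d + j %/ d)))%N.
Proof.
move=> xH yH; rewrite expn_sum; apply: absz_det_le => i j.
rewrite mxE abszM !abszX expnD.
by apply: leq_mul; apply: leq_expn2r.
Qed.

Lemma logn_prod (I : finType) (l : nat) (F : I -> nat) :
    (forall i, 0 < F i)%N ->
  logn l (\prod_i F i) = (\sum_i logn l (F i))%N.
Proof.
move=> F0.
suff [] : ((0 < \prod_i F i) /\ logn l (\prod_i F i) = \sum_i logn l (F i))%N by [].
apply: (big_ind2 (fun a b => 0 < a /\ logn l a = b)%N) => //.
  by rewrite logn1.
by move=> a b a' b' [a0 <-] [a'0 <-]; rewrite muln_gt0 a0 a'0 lognM.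
Qed.

(** The determinant method: compare the power of l dividing the monomial
    determinant with the size of that determinant. *)
Lemma class_bound (d m H l k w : nat) (f g : {poly int})
    (x y : 'I_(m.+1 * d) -> int) :
    (0 < d)%N -> (size f <= d.+1)%N -> (size g <= d.+1)%N ->
    (forall i, f.[x i] = y i * g.[x i]) ->
    (forall i, absz (x i) <= H)%N -> (forall i, absz (y i) <= H)%N ->
    prime l -> (forall i j, ((l ^ k)%N%:Z %| x j - x i)%Z) ->
    (forall i, ~~ ((l ^ w)%N%:Z %| g.[x i])%Z) ->
    \det (monomial_mx d x y) != 0 ->
  ((l ^ k) ^ (m.+1 * d).-1 <=
     (m.+1 * d) ^ 2 * H ^ (d.-1 + m) * (l ^ w) ^ m.*2)%N.
Proof.
set n := (m.+1 * d)%N in x y * => d0 sf sg e xH yH lP qx gx DN0.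
have n0 : (0 < n)%N by rewrite muln_gt0.
set D := \det _ in DN0; have D0 : (0 < absz D)%N by rewrite absz_gt0.
have g0 i : (0 < absz g.[x i]%R)%N.
  by rewrite absz_gt0; apply: contraNneq (gx i) => ->; apply: dvdz0.
have Pg0 : (0 < \prod_i absz g.[x i]%R ^ m)%N.
  by rewrite prodn_gt0 // => i; rewrite expn_gt0 g0.
have lg i : (logn l (absz g.[x i]%R) <= w)%N.
  rewrite leqNgt; apply: contra (gx i) => lw.
  by rewrite dvdzE /= pfactor_dvdn // ltnW.
have lPg : (logn l (\prod_i absz g.[x i]%R ^ m) <= n * (m * w))%N.
  rewrite logn_prod => [|i]; last by rewrite expn_gt0 g0.
  rewrite -[n in leqRHS]card_ord -sum_nat_const; apply: leq_sum => i _.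
  by rewrite lognX leq_mul2l lg orbT.
have dv : (l ^ (k * 'C(n, 2)) %| absz D * \prod_i absz g.[x i]%R ^ m)%N.
  have := congr1 absz (det_monomial_mx d0 sf sg e); rewrite -/n -/D.
  rewrite !abszM absz_prod (eq_bigr _ (fun i _ => abszX _ _)) => ->.
  by rewrite expnM dvdn_mulr // dvdn_vandermonde.
have le1 : (l ^ (k * 'C(n, 2)) <= n`! * H ^ (\sum_(j < n) (j %% d + j %/ d)) *
     l ^ (n * (m * w)))%N.
  apply: leq_trans (leq_mul (det_monomial_mx_le d xH yH) (leqnn _)).
  apply: (@leq_trans (l ^ (logn l (absz D) + n * (m * w)))).
    rewrite leq_exp2l ?prime_gt1 //; move: dv; rewrite pfactor_dvdn ?muln_gt0 ?D0 //.
    by rewrite lognM // => /leq_trans; apply; rewrite leq_add2l.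
  by rewrite expnD leq_mul2r dvdn_leq ?orbT // pfactor_dvdnn.
have fact_le : (n`! <= n ^ n)%N.
  elim: (n) => // r IH; rewrite factS expnS leq_mul2l /=.
  by apply: leq_trans IH _; apply: leq_expn2r.
(* Both sides are raised to the power n to remove the factor n / 2 from the
   exponents. *)
rewrite -(leq_exp2r _ _ n0) -expnM.
have -> : ((l ^ k) ^ (n.-1 * n) = (l ^ (k * 'C(n, 2))) ^ 2)%N.
  have e2 : ('C(n, 2) * 2 = n * n.-1)%N.
    by rewrite -[LHS]/('C(n, 2) * 2`!)%N bin_ffact ffactnS ffactn1.
  by rewrite -!expnM -mulnA e2 (mulnC n).
apply: (@leq_trans ((n ^ n * H ^ (\sum_(j < n) (j %% d + j %/ d)) *
     l ^ (n * (m * w))) ^ 2)).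
  by rewrite leq_exp2r // (leq_trans le1) // !leq_mul2r fact_le !orbT.
have pow_eq N E S : (S.*2 = N * E -> (N ^ N * H ^ S * l ^ (N * (m * w))) ^ 2 =
    (N ^ 2 * H ^ E * (l ^ w) ^ m.*2) ^ N)%N.
  move=> eS; rewrite !expnMn -!expnM.
  rewrite -expnD addnn (muln2 S) eS (mulnC E) muln2.
  by congr (_ * _ * _ ^ _)%N; lia.
by rewrite (pow_eq _ _ _ (sum_monomial_degrees m d0)).
Qed.

(** * Lifting the curve to the integers *)

(** The bound of [small_kernel] for monomials x^i y^j with i <= d, j <= 1 on
    [0, H]^2. *)
Definition kernel_bound (d H : nat) : nat :=
  ((2 * d.+1)`! * (H ^ d.+1) ^ (2 * d.+1))%N.

Lemma sum_monomial_split (R : nmodType) (D : nat) (E : nat -> nat -> R) :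
    (0 < D)%N ->
  \sum_(j < 2 * D) E (j %% D)%N (j %/ D)%N =
    \sum_(i < D) E i 0%N + \sum_(i < D) E i 1%N.
Proof.
move=> D0; rewrite -(big_mkord xpredT (fun j => E (j %% D)%N (j %/ D)%N)).
rewrite mul2n -addnn big_mkord big_split_ord /=.
congr (_ + _); apply: eq_bigr => i _; have iD := ltn_ord i.
  by rewrite modn_small // divn_small.
by rewrite modnDl modn_small // divnDl // divnn D0 divn_small.
Qed.

(** The coefficients of f - y g form a nonzero kernel vector. *)
Lemma det_monomial_mx_eq0 (F : fieldType) (d : nat) (f g : {poly F})
    (x y : 'I_(2 * d.+1) -> F) :
    (size f <= d.+1)%N -> (size g <= d.+1)%N -> g != 0 ->
    (forall i, f.[x i] = y i * g.[x i]) ->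
  \det (monomial_mx d.+1 x y) = 0.
Proof.
move=> sf sg gN0 e; apply/eqP; rewrite -det_tr.
pose v (a b : nat) := if b == 0%N then f`_a else - g`_a.
apply/det0P; exists (\row_j v (j %% d.+1)%N (j %/ d.+1)%N).
  apply: contra_neq gN0 => v0; apply/polyP => i; rewrite coef0.
  have [id|] := ltnP i d.+1; last first.
    by move=> di; rewrite nth_default // (leq_trans sg).
  have jn : (d.+1 + i < 2 * d.+1)%N by lia.
  move/rowP: v0 => /(_ (Ordinal jn)); rewrite !mxE /=.
  rewrite modnDl modn_small // divnDl // divnn divn_small //.
  by rewrite /v /= => /eqP; rewrite oppr_eq0 => /eqP.
apply/rowP => i; rewrite !mxE.
pose E a b := v a b * (x i ^+ a * y i ^+ b).
rewrite (eq_bigr (fun j : 'I_(2 * d.+1) => E (j %% d.+1)%N (j %/ d.+1)%N)).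
  rewrite sum_monomial_split // /E /v /=.
  have := e i; rewrite (horner_coef_wide _ sf) (horner_coef_wide _ sg) => e'.
  under eq_bigr do rewrite expr0 mulr1.
  rewrite e' mulr_sumr -big_split /= big1 // => j _.
  by rewrite expr1 mulNr (mulrC (y i)) mulrA subrr.
by move=> j _; rewrite !mxE.
Qed.

(** The minors of order 2(d + 1) vanish modulo p and are smaller than p, so they
    vanish; a small integral kernel vector is then a lift of the curve. *)
Lemma integer_lift (p d H : nat) (T : Type) (a b : T -> nat)
    (F G : {poly 'F_p}) :
    prime p -> (0 < H)%N ->
    ((2 * d.+1)`! * H ^ (d.+1 ^ 2) < p)%N ->
    (size F <= d.+1)%N -> (size G <= d.+1)%N -> G != 0 ->
    (forall t, a t <= H)%N -> (forall t, b t <= H)%N ->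
    (forall t, F.[(a t)%:R] = (b t)%:R * G.[(a t)%:R]) ->
  exists f g : {poly int}, [/\ (size f <= d.+1)%N, (size g <= d.+1)%N,
    (f != 0) || (g != 0),
    forall i, (absz (g`_i)%R <= kernel_bound d H)%N
    & forall t, f.[(a t)%:Z] = (b t)%:Z * g.[(a t)%:Z]].
Proof.
move=> pP H0 Hp sF sG GN0 aH bH e; set D := d.+1 in Hp sF sG *.
pose M (t : T) (j : 'I_(2 * D)) : int :=
  (a t)%:Z ^+ (j %% D) * (b t)%:Z ^+ (j %/ D).
have MB t j : `|M t j| <= (H ^ D)%N%:Z.
  rewrite /M -abszE lez_nat abszM !abszX /=.
  have jD : (j %% D < D)%N by rewrite ltn_pmod.
  have jm : (j %/ D < 2)%N by rewrite ltn_divLR.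
  apply: (@leq_trans (H ^ (j %% D) * H ^ (j %/ D))).
    by apply: leq_mul; apply: leq_expn2r.
  by rewrite -expnD leq_pexp2l //; lia.
have det0 (u : 'I_(2 * D) -> T) : \det (\matrix_(i, j) M (u i) j) = 0.
  set A := \matrix_(i, j) _.
  have AE : A = monomial_mx D (fun i => (a (u i))%:Z) (fun i => (b (u i))%:Z).
    by apply/matrixP=> i j; rewrite !mxE.
  have le : (absz (\det A)%R <= (2 * D)`! * H ^ (D ^ 2))%N.
    rewrite AE; apply: (leq_trans (det_monomial_mx_le D (H := H) _ _)) => [i|i|].
    + exact: aH.
    + exact: bH.
    rewrite leq_mul2l; apply/orP; right; apply: leq_pexp2l => //.
    by have := @sum_monomial_degrees D 1 isT; lia.
  have : (\det A)%:~R = 0 :> 'F_p.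
    rewrite -(det_map_mx (intr : int -> 'F_p)).
    rewrite -[RHS](@det_monomial_mx_eq0 _ d F G (fun i => (a (u i))%:R)
      (fun i => (b (u i))%:R)) //.
    congr (\det _); apply/matrixP=> i j; rewrite !mxE.
    by rewrite rmorphM !rmorphXn.
  move/eqP; rewrite -(dvdz_pcharf (pchar_Fp pP)) dvdzE /= => pd.
  apply/eqP; rewrite -absz_eq0; apply: contraLR pd => N0.
  by rewrite gtnNdvd ?lt0n // (leq_ltn_trans le).
have B1 : 1 <= (H ^ D)%N%:Z by rewrite lez_nat expn_gt0 H0.
have [c [[j0 cj0] cB cM]] := small_kernel B1 MB det0.
pose c' (i k : nat) : int := oapp c 0 (insub (k * D + i)%N).
have c'E (j : 'I_(2 * D)) : c j = c' (j %% D)%N (j %/ D)%N.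
  by rewrite /c' -divn_eq valK.
exists (\poly_(i < D) c' i 0%N), (\poly_(i < D) - c' i 1%N); split.
- exact: size_poly.
- exact: size_poly.
- rewrite -negb_and; apply: contra_neqN cj0 => /andP[/eqP f0 /eqP g0].
  have jD : (j0 %% D < D)%N by rewrite ltn_pmod.
  have jm : (j0 %/ D < 2)%N by rewrite ltn_divLR.
  rewrite c'E; move: jm; case: (j0 %/ D)%N => [_|[_|//]].
    have := congr1 (fun P : {poly int} => P`_(j0 %% D)) f0.
    by rewrite coef_poly jD coef0.
  have := congr1 (fun P : {poly int} => P`_(j0 %% D)) g0.
  by rewrite coef_poly jD coef0 => /eqP; rewrite oppr_eq0 => /eqP.
- move=> i; rewrite coef_poly; case: ifP => // _; rewrite abszN /c'.
  case: insubP => //= j _ _; have := cB j.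
  by rewrite -abszE -[(H ^ D)%N%:Z]natz -natrX -natrM natz lez_nat.
- move=> t; have := cM t.
  pose E i k := c' i k * ((a t)%:Z ^+ i * (b t)%:Z ^+ k).
  rewrite (eq_bigr (fun j : 'I_(2 * D) => E (j %% D)%N (j %/ D)%N)); last first.
    by move=> j _; rewrite c'E.
  rewrite sum_monomial_split // => /eqP; rewrite addr_eq0 => /eqP s0.
  rewrite !horner_poly mulr_sumr.
  under eq_bigr => i _ do rewrite -[(a t)%:Z ^+ i]mulr1 -[1](expr0 (b t)%:Z).
  rewrite s0 -sumrN; apply: eq_bigr => i _; rewrite /E expr1 mulNr mulrN; congr (- _).
  by rewrite mulrA mulrC.
Qed.

(** * Counting the points *)

Lemma card_bigcup_le (I T : finType) (A : I -> {set T}) :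
  (#|\bigcup_i A i| <= \sum_i #|A i|)%N.
Proof.
apply: (big_ind2 (fun (B : {set T}) c => #|B| <= c)%N) => //.
  by rewrite cards0.
move=> B1 c1 B2 c2 le1 le2; apply: leq_trans (leq_add le1 le2).
exact: leq_card_setU.
Qed.

Lemma natr_Fp_inj (p i j : nat) :
  prime p -> (i < p)%N -> (j < p)%N -> i%:R = j%:R :> 'F_p -> i = j.
Proof.
move=> pP ip jp /(congr1 val) /=.
by rewrite !val_Fp_nat // !modn_small.
Qed.

(** By [class_bound], no residue class modulo l^k contains (m + 1) d of the
    points. *)
Lemma card_good (d m p H l k w : nat) (F G : {poly 'F_p}) (f g : {poly int})
    (S : {set 'I_H.+1}) (b : 'I_H.+1 -> nat) :
    (0 < d)%N -> prime p -> (H < p)%N ->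
    coprimep F G -> maxn (size F) (size G) = d.+1 ->
    (size f <= d.+1)%N -> (size g <= d.+1)%N ->
    (forall t, t \in S -> b t <= H)%N ->
    (forall t : 'I_H.+1, t \in S -> F.[t%:R] = (b t)%:R * G.[t%:R]) ->
    (forall t : 'I_H.+1, t \in S -> f.[t%:Z] = (b t)%:Z * g.[t%:Z]) ->
    prime l ->
    (forall t : 'I_H.+1, t \in S -> ~~ ((l ^ w)%N%:Z %| g.[t%:Z])%Z) ->
    ((m.+1 * d) ^ 2 * H ^ (d.-1 + m) * (l ^ w) ^ m.*2 <
       (l ^ k) ^ (m.+1 * d).-1)%N ->
  (#|S| <= l ^ k * (m.+1 * d))%N.
Proof.
move=> d0 pP Hp co sFG sf sg bH eF ef lP gw big.
set n := (m.+1 * d)%N in big *; have l0 := prime_gt0 lP.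
pose C (r : 'I_(l ^ k)) := [set t in S | (t %% l ^ k)%N == r].
have -> : S = \bigcup_r C r.
  apply/finset.setP=> t; apply/idP/finset.bigcupP => [tS|[r _]]; last by rewrite inE => /andP[].
  have rq : (t %% l ^ k < l ^ k)%N by rewrite ltn_pmod ?expn_gt0 ?l0.
  by exists (Ordinal rq); rewrite // inE tS /=.
apply: leq_trans (card_bigcup_le _) _.
rewrite -[(l ^ k)%N in leqRHS]card_ord -sum_nat_const; apply: leq_sum => r _.
rewrite leqNgt; apply: contraL big => /ltnW nC; rewrite -leqNgt.
pose t (i : 'I_n) : 'I_H.+1 := enum_val (widen_ord nC i).
have tC i : t i \in C r by apply: enum_valP.
have tS i : t i \in S by have := tC i; rewrite inE => /andP[].
have tr i : (t i %% l ^ k)%N = r by have := tC i; rewrite inE => /andP[_ /eqP].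
have tI : injective t.
  by move=> i j /enum_val_inj /(congr1 val) /= ij; apply: val_inj.
pose x i := (t i)%:Z; pose y i := (b (t i))%:Z.
apply: (@class_bound d m H l k w f g x y) => //.
- by move=> i; apply: ef.
- by move=> i; rewrite /x absz_nat -ltnS ltn_ord.
- by move=> i; apply: bH.
- move=> i j; rewrite -eqz_mod_dvd /x !modz_nat; apply/eqP; congr Posz.
  by rewrite !tr.
- by move=> i; apply: gw.
apply: (contra_neq (z1 := (\det (monomial_mx d x y))%:~R) (z2 := 0 : 'F_p)) => [->//|].
rewrite -(det_map_mx (intr : int -> 'F_p)).
have -> : map_mx (intr : int -> 'F_p) (monomial_mx d x y) =
    monomial_mx d (fun i => (t i)%:R) (fun i => (b (t i))%:R).
  by apply/matrixP=> i j; rewrite !mxE rmorphM !rmorphXn.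
apply: det_monomial_mx_neq0 co sFG _ _ => // [i j|i]; last exact: eF.
have lt u : (t u < p)%N by apply: leq_trans Hp.
by move/(natr_Fp_inj pP (lt i) (lt j)) => ij; apply: tI; apply: val_inj.
Qed.

Lemma absz_horner_le (d H B : nat) (g : {poly int}) (x : nat) :
    (0 < H)%N -> (size g <= d.+1)%N -> (forall i, absz (g`_i)%R <= B)%N ->
    (x <= H)%N ->
  (absz (g.[x%:Z])%R <= d.+1 * (B * H ^ d))%N.
Proof.
move=> H0 sg gB xH; rewrite (horner_coef_wide _ sg).
rewrite -[in leqRHS](card_ord d.+1) -sum_nat_const.
apply: (big_ind2 (fun (u : int) v => absz u <= v)%N) => //.
  by move=> u1 v1 u2 v2 le1 le2; apply: leq_trans (leq_add le1 le2); lia.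
move=> i _; rewrite abszM abszX leq_mul //=.
apply: (@leq_trans (H ^ i)); first exact: leq_expn2r.
by rewrite leq_pexp2l // -ltnS.
Qed.

Lemma coprime_prod_dvd (I : finType) (q : I -> nat) (N : nat) :
    (forall i j, i != j -> coprime (q i) (q j)) ->
    (forall i, q i %| N)%N ->
  (\prod_i q i %| N)%N.
Proof.
move=> co qN.
have : uniq (index_enum I) by rewrite /index_enum -enumT enum_uniq.
elim: (index_enum I) => [|i r IH] /=; first by rewrite big_nil dvd1n.
case/andP=> ir ur; rewrite big_cons Gauss_dvd ?qN ?IH //.
elim: r ir {ur IH} => [|j r IH]; first by rewrite big_nil coprimen1.
rewrite inE negb_or => /andP[ij ir]; rewrite big_cons coprimeMr co //.
exact: IH.
Qed.

Lemma card_roots_le (d H : nat) (g : {poly int}) (S : {set 'I_H.+1}) :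
    g != 0 -> (size g <= d.+1)%N -> (forall t : 'I_H.+1, t \in S -> g.[t%:Z] = 0) ->
  (#|S| <= d)%N.
Proof.
move=> gN0 sg gS; rewrite -ltnS; apply: leq_trans sg.
have := max_poly_roots gN0 (rs := [seq (nat_of_ord t)%:Z | t <- enum S]).
rewrite size_map -cardE; apply.
  by apply/allP => _ /mapP[t tS ->]; apply/rootP/gS; rewrite mem_enum in tS.
by rewrite map_inj_uniq ?enum_uniq // => i j [] /val_inj.
Qed.

(** For the j-th prime l, the modulus is the least power of l that is at least X,
    and the threshold l^w is the least power that is at least Y.  If all the
    thresholds divided g(x), so would their product, which is at least Y^s and
    hence larger than |g(x)|. *)
Lemma card_points (d m s p H X Y L : nat) (ell : 'I_s -> nat)
    (F G : {poly 'F_p}) (A : {set 'I_H.+1}) (b : 'I_H.+1 -> nat) :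
    (0 < d)%N -> prime p -> (0 < H)%N ->
    ((2 * d.+1)`! * H ^ (d.+1 ^ 2) < p)%N ->
    coprimep F G -> maxn (size F) (size G) = d.+1 -> G != 0 ->
    (forall t, t \in A -> b t <= H)%N ->
    (forall t : 'I_H.+1, t \in A -> F.[t%:R] = (b t)%:R * G.[t%:R]) ->
    injective ell -> (forall j, prime (ell j)) -> (forall j, ell j <= L)%N ->
    (1 < X)%N -> (1 < Y)%N ->
    (d.+1 * (kernel_bound d H * H ^ d) < Y ^ s)%N ->
    ((m.+1 * d) ^ 2 * H ^ (d.-1 + m) * (L * Y) ^ m.*2 < X ^ (m.+1 * d).-1)%N ->
  (#|A| <= d + s * (L * X * (m.+1 * d)))%N.
Proof.
move=> d0 pP H0 Hp co sFG GN0 bH eF ellI ellP ellL X1 Y1 Ys Xn.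
have sF : (size F <= d.+1)%N by rewrite -sFG leq_maxl.
have sG : (size G <= d.+1)%N by rewrite -sFG leq_maxr.
have ltHp : (H < p)%N.
  apply: leq_ltn_trans Hp; apply: leq_trans (leq_pmull _ (fact_gt0 _)).
  by rewrite -{1}(expn1 H) leq_pexp2l // expn_gt0.
have [Ad|dA] := leqP #|A| d; first exact: leq_trans (leq_addr _ _).
have [f [g [sf sg fgN0 gB ef0]]] : exists f g : {poly int},
    [/\ (size f <= d.+1)%N, (size g <= d.+1)%N,
    (f != 0) || (g != 0), forall i, (absz (g`_i)%R <= kernel_bound d H)%N
    & forall t : {t | t \in A}, f.[(val t)%:Z] = (b (val t))%:Z * g.[(val t)%:Z]].
  apply: (integer_lift pP H0 Hp sF sG GN0) => [[t tA]|[t tA]|[t tA]] /=.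
  - by rewrite -ltnS.
  - exact: bH.
  - exact: eF.
have ef (t : 'I_H.+1) : t \in A -> f.[t%:Z] = (b t)%:Z * g.[t%:Z].
  by move=> tA; apply: (ef0 (exist _ t tA)).
have gN0 : g != 0.
  apply: contraTneq dA => g0; rewrite -leqNgt; move: fgN0; rewrite g0 eqxx orbF.
  by move=> fN0; apply: (card_roots_le fN0 sf) => t /ef ->; rewrite g0 horner0 mulr0.
pose k j := up_log (ell j) X; pose w j := up_log (ell j) Y.
have up_le j Z : (1 < Z)%N -> (ell j ^ up_log (ell j) Z <= L * Z)%N.
  move=> Z1; have l1 := prime_gt1 (ellP j).
  have := up_log_bounds l1 Z1; case: up_log => [|e] /andP[lt _].
    by rewrite expn0 muln_gt0 (leq_trans (prime_gt0 (ellP j)) (ellL j)) ltnW.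
  by rewrite expnS leq_mul // ltnW.
pose A0 := [set t in A | g.[(nat_of_ord t)%:Z] == 0].
pose S j := [set t in A | ~~ ((ell j ^ w j)%N%:Z %| g.[(nat_of_ord t)%:Z])%Z].
have cover : A \subset A0 :|: \bigcup_j S j.
  apply/fintype.subsetP => t tA; rewrite finset.in_setU inE tA /=.
  have [//|gt0] := eqVneq; apply/finset.bigcupP.
  apply/exists_inP; apply: contraTT (Ys) => /exists_inPn nS.
  have tH : (t <= H)%N by rewrite -ltnS.
  rewrite -leqNgt; apply: leq_trans (absz_horner_le H0 sg gB tH).
  apply: (@leq_trans (\prod_(j < s) ell j ^ w j)).
    rewrite -[s in (Y ^ s)%N]card_ord -prod_nat_const; apply: leq_prod => j _.
    exact/up_logP/prime_gt1.
  apply: dvdn_leq; first by rewrite absz_gt0.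
  apply: coprime_prod_dvd => [i j ij|j].
    apply: coprimeXl; apply: coprimeXr; rewrite prime_coprime // dvdn_prime2 //.
    by rewrite (inj_eq ellI).
  by have := nS j isT; rewrite inE tA negbK dvdzE.
apply: (leq_trans (subset_leq_card cover)).
apply: (leq_trans (leq_card_setU _ _)); apply: leq_add.
  by apply: (card_roots_le gN0 sg) => t; rewrite inE => /andP[_ /eqP].
apply: (leq_trans (card_bigcup_le _)).
rewrite -[s in (s * _)%N]card_ord -sum_nat_const; apply: leq_sum => j _.
apply: (@leq_trans (ell j ^ k j * (m.+1 * d))); last first.
  by rewrite leq_mul2r up_le ?orbT.
apply: (@card_good d m p H (ell j) (k j) (w j) F G f g (S j) b) => //.
- by move=> t; rewrite inE => /andP[/bH].
- by move=> t; rewrite inE => /andP[/eF].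
- by move=> t; rewrite inE => /andP[/ef].
- by move=> t; rewrite inE => /andP[].
apply: (@leq_trans (X ^ (m.+1 * d).-1)); last exact/leq_expn2r/up_logP/prime_gt1.
by apply: leq_ltn_trans Xn; rewrite leq_mul2l leq_expn2r ?orbT ?up_le.
Qed.

(** * From rational functions to points in a box *)

(** With psi = f / g, the translated pair is F = f(X + K) - L g(X + K) and
    G = g(X + K); the map from abscissae to values of psi covers the
    intersection. *)
Lemma rimage_interval_points (p d H : nat) (psi : {fraction {poly 'F_p}})
    (K L : int) :
    (0 < d)%N -> rdeg psi = d ->
  exists (F G : {poly 'F_p}) (A : {set 'I_H.+1}) (b : 'I_H.+1 -> nat),
    [/\ coprimep F G, maxn (size F) (size G) = d.+1 & G != 0] /\
    [/\ forall t, t \in A -> (b t <= H)%N,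
        forall t : 'I_H.+1, t \in A -> F.[t%:R] = (b t)%:R * G.[t%:R]
      & (#|rimage psi (interval_mod p K H) :&: interval_mod p L H| <= #|A|)%N].
Proof.
move=> d0 psid; pose f := rnum psi; pose g := rden psi.
have gN0 : g != 0 by apply: rden_neq0.
have co : coprimep f g by apply: coprimep_rnum_rden.
have sfg : maxn (size f) (size g) = d.+1.
  have sg : (0 < size g)%N by rewrite lt0n size_poly_eq0.
  by move: psid; rewrite /rdeg -/f -/g; lia.
pose h : {poly 'F_p} := 'X + (K%:~R)%:P.
have sh : size h = 2 by rewrite size_XaddC.
pose F := (f - (L%:~R)%:P * g) \Po h; pose G := g \Po h.
have hE (t : 'F_p) : h.[t] = K%:~R + t by rewrite hornerD hornerX hornerC addrC.
have [coFG sFG] : coprimep F G /\ maxn (size F) (size G) = d.+1.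
  split.
    apply: coprimep_comp_poly; rewrite coprimep_sym -mulNr -polyCN addrC.
    by rewrite coprimep_addl_mul coprimep_sym.
  rewrite !size_comp_poly2 // -sfg.
  have [fg|gf] := leqP (size f) (size g).
    apply/maxn_idPr; apply: (leq_trans (size_polyD _ _)).
    rewrite size_polyN geq_max fg /=.
    by rewrite mul_polyC size_scale_leq.
  have lt : (size (- ((L%:~R)%:P * g)) < size f)%N.
    by rewrite size_polyN mul_polyC (leq_ltn_trans (size_scale_leq _ _)).
  by rewrite size_polyDl //; apply/maxn_idPl/ltnW.
pose A := [set t : 'I_H.+1 | (G.[t%:R] != 0) &&
  [exists u : 'I_H.+1, F.[t%:R] == u%:R * G.[t%:R]]].
pose b (t : 'I_H.+1) : nat :=
  odflt ord0 [pick u : 'I_H.+1 | F.[t%:R] == u%:R * G.[t%:R]].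
exists F, G, A, b; split.
  by split=> //; rewrite -size_poly_eq0 size_comp_poly2 // size_poly_eq0.
split.
- by move=> t _; rewrite -ltnS ltn_ord.
- move=> t; rewrite inE => /andP[_ /existsP[u uE]]; rewrite /b.
  by case: pickP => [v /eqP //|/(_ u)]; rewrite uE.
pose val_at (t : 'I_H.+1) : 'F_p := reval psi (K%:~R + t%:R).
apply: leq_trans (leq_imset_card val_at A).
apply/subset_leq_card/fintype.subsetP => y; rewrite inE => /andP[/imsetP[x]].
rewrite inE => /andP[/imsetP[t _ xE] gx yE] /imsetP[u _ yE'].
have xE2 : x = K%:~R + t%:R by rewrite xE rmorphD /= -pmulrn.
rewrite -/g in gx; apply/imsetP; exists t; last by rewrite yE xE2.
rewrite inE /G /F !horner_comp hE -xE2 gx /=; apply/existsP; exists u.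
rewrite hornerD hornerN hornerM hornerC subr_eq -mulrDl.
move: yE; rewrite yE' /reval -/f -/g rmorphD /= -pmulrn => yE.
by rewrite addrC yE divfK.
Qed.

(** * Choice of parameters *)

Lemma prime_sequence :
  exists ell : nat -> nat, injective ell /\ forall i, prime (ell i).
Proof.
pose next q := let: exist2 r _ _ := prime_above q in r.
have next_gt q : (q < next q)%N by rewrite /next; case: prime_above.
have nextP q : prime (next q) by rewrite /next; case: prime_above.
exists (fun i => iter i.+1 next 0%N); split=> [|i]; last exact: nextP.
have mono : {homo (fun i => iter i.+1 next 0%N) : i j / (i < j)%N}.
  by apply: homo_ltn => [|i]; [apply: ltn_trans|exact: next_gt].
move=> i j ij; case: (ltngtP i j) => // /mono; rewrite ij ltnn //.
Qed.

Lemma powR_trunc (R : realType) (c h t : R) :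
    1 <= c -> 1 <= h -> 0 <= t ->
  let X := (Num.trunc (c * h `^ t)).+1 in
  [/\ (1 < X)%N, c * h `^ t < X%:R & X%:R <= 2 * c * h `^ t].
Proof.
move=> c1 h1 t0 X.
have ht1 : 1 <= h `^ t by rewrite -(powRr0 h) ler_powR.
have ch1 : 1 <= c * h `^ t by apply: mulr_ege1.
have /andP[le lt] := truncn_itv (le_trans ler01 ch1).
split=> //; first by rewrite ltnS truncn_gt0.
by rewrite /X -natr1; lra.
Qed.

(** The threshold is Y of order H^eta and the modulus X of order
    H^(1/d + eps).  The exponents of H in the last condition on X compare as
    d - 1 + m + 2 eta m <= (1/d + eps) ((m + 1) d - 1), which holds once
    (m + 1) eps >= d and 2 eta <= eps, and Y^s dominates K0 H^C0 when
    eta s = C0.  Constant factors are absorbed by multiplying H^eta by K0 and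
    H^(1/d + eps) by c. *)
Lemma parameters (R : realType) (d K0 C0 : nat) (eps : R) :
    (2 <= d)%N -> (0 < K0)%N -> 0 < eps ->
  exists m s : nat, forall L : nat, (0 < L)%N ->
  exists C : R, 0 <= C /\ forall H : nat, (0 < H)%N ->
  exists X Y : nat,
  [/\ (1 < X)%N, (1 < Y)%N, (K0 * H ^ C0 < Y ^ s)%N,
    ((m.+1 * d) ^ 2 * H ^ (d.-1 + m) * (L * Y) ^ m.*2 < X ^ (m.+1 * d).-1)%N
    & (d + s * (L * X * (m.+1 * d)))%:R <= C * H%:R `^ (d%:R^-1 + eps)].
Proof.
move=> d2 K00 e0.
have d0 : 0 < d%:R :> R by rewrite ltr0n; lia.
pose m := Num.trunc (d%:R / eps).
have me : d%:R <= m.+1%:R * eps.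
  have /andP[_ /ltW] := truncn_itv (ltW (divr_gt0 d0 e0)).
  by rewrite ler_pdivrMr.
pose s := (Num.trunc (2 * C0%:R / eps)).+1.
have se : 2 * C0%:R <= s%:R * eps.
  have ge0 : 0 <= 2 * C0%:R / eps by rewrite divr_ge0 ?mulr_ge0 ?ler0n ?ltW.
  have /andP[_ /ltW] := truncn_itv ge0.
  by rewrite ler_pdivrMr.
have s0 : 0 < s%:R :> R by rewrite ltr0n.
pose eta : R := C0%:R / s%:R.
have eta0 : 0 <= eta by rewrite divr_ge0 ?ler0n.
have eta_le : 2 * eta <= eps by rewrite /eta mulrA ler_pdivrMr // (mulrC eps).
have etas : eta * s%:R = C0%:R by rewrite divfK // gt_eqF.
pose alpha := d%:R^-1 + eps.
have alpha0 : 0 <= alpha by rewrite addr_ge0 ?invr_ge0 ?ltW.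
exists m, s => L L0; set n := (m.+1 * d)%N.
have n1 : (0 < n.-1)%N by rewrite /n; nia.
pose c : nat := (n ^ 2 * (2 * L * K0) ^ m.*2)%N.
have c0 : (0 < c)%N by rewrite muln_gt0 !expn_gt0 !muln_gt0 L0 K00 /=; lia.
exists (d + s * (L * (2 * c) * n))%:R; split=> [|H H0]; first exact: ler0n.
pose h : R := H%:R; have h1 : 1 <= h by rewrite ler1n.
have hge0 : 0 <= h by apply: le_trans h1.
have h0 : h != 0 by rewrite gt_eqF // (lt_le_trans ltr01).
have [] := @powR_trunc R K0%:R h eta _ h1 eta0; first by rewrite ler1n.
set Y := (Num.trunc _).+1 => Y1 Ylt Yle.
have [] := @powR_trunc R c%:R h alpha _ h1 alpha0; first by rewrite ler1n.
set X := (Num.trunc _).+1 => X1 Xlt Xle.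
have hp0 t : 0 <= h `^ t by apply: powR_ge0.
exists X, Y; split=> //.
- rewrite -(ltr_nat R) natrM !natrX -/h.
  apply: (@le_lt_trans _ _ ((K0%:R * h `^ eta) ^+ s)).
    rewrite exprMn -[(h `^ eta) ^+ s]powR_mulrn // -powRrM etas.
    rewrite powR_mulrn ?ler0n ?hge0 //.
    by rewrite ler_wpM2r ?exprn_ge0 ?ler0n ?hge0 // ler_eXnr ?ler1n.
  by rewrite ltr_pXn2r ?nnegrE ?mulr_ge0 ?ler0n.
- have lhsE : (n ^ 2 * H ^ (d.-1 + m) * (L * Y) ^ m.*2)%:R =
      n%:R ^+ 2 * h ^+ (d.-1 + m) * (L%:R * Y%:R) ^+ m.*2 :> R.
    by rewrite (natrM _ (_ * _)%N) (natrM _ (n ^ 2)%N) !natrX (natrM _ L).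
  rewrite -(ltr_nat R) lhsE natrX.
  apply: (@le_lt_trans _ _ ((c%:R * h `^ alpha) ^+ n.-1)); last first.
    by rewrite ltr_pXn2r ?nnegrE ?mulr_ge0 ?ler0n.
  apply: (@le_trans _ _ (n%:R ^+ 2 * h ^+ (d.-1 + m) *
      (L%:R * (2 * K0%:R * h `^ eta)) ^+ m.*2)).
    rewrite ler_wpM2l ?mulr_ge0 ?exprn_ge0 ?ler0n ?hge0 //.
    by apply: lerXn2r; rewrite ?nnegrE ?mulr_ge0 ?ler0n // ler_wpM2l.
  have -> : n%:R ^+ 2 * h ^+ (d.-1 + m) * (L%:R * (2 * K0%:R * h `^ eta)) ^+ m.*2
     = c%:R * (h ^+ (d.-1 + m) * (h `^ eta) ^+ m.*2).
    by rewrite /c (natrM _ (n ^ 2)%N) !natrX (natrM _ (2 * L)%N) natrM !exprMn; ring.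
  rewrite exprMn; apply: ler_pM; rewrite ?mulr_ge0 ?exprn_ge0 ?ler0n ?hge0 //.
    by rewrite ler_eXnr ?ler1n.
  rewrite -!powR_mulrn ?ler0n ?hge0 // -!powRrM -powRD ?h0 ?implybT //.
  apply: ler_powR => //.
  have en : n.-1%:R = m.+1%:R * d%:R - 1 :> R.
    by rewrite -natrM -/n -[in RHS](prednK (leq_trans n1 (leq_pred n))) -natr1 addrK.
  have ed : (d.-1 + m)%:R = d%:R + m%:R - 1 :> R.
    by rewrite natrD -[in RHS](prednK (ltnW d2)) -natr1 addrAC addrK.
  have -> : alpha * n.-1%:R = m.+1%:R - d%:R^-1 + eps * (m.+1%:R * d%:R - 1).
    by rewrite en /alpha; field; rewrite gt_eqF.
  rewrite ed -muln2 natrM -natr1.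
  have dd : d%:R^-1 <= 1 :> R by rewrite invf_le1 // ler1n ltnW.
  have d2' : 2 <= d%:R :> R by rewrite ler_nat.
  have m0 : 0 <= m%:R :> R by rewrite ler0n.
  have e1 : 2 * eta * m%:R <= eps * m%:R by rewrite ler_wpM2r.
  move: me; rewrite -natr1 => me.
  have : (m%:R + 1) * eps <= (m%:R + 1) * eps * (d%:R - 1).
    by apply: ler_peMr; [rewrite mulr_ge0 ?addr_ge0 // ltW|lra].
  lra.
have natE a b e f : (a + b * (e * f * n))%:R =
    a%:R + b%:R * (e%:R * f%:R * n%:R) :> R.
  by rewrite natrD (natrM _ b) (natrM _ (e * f)%N) (natrM _ e).
rewrite -/alpha -/h !natE mulrDl; apply: lerD.
  by rewrite ler_peMr ?ler0n // -(powRr0 h) ler_powR.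
have -> : s%:R * (L%:R * (2 * c)%:R * n%:R) * h `^ alpha =
    s%:R * (L%:R * (2 * c%:R * h `^ alpha) * n%:R).
  by rewrite (natrM _ 2) -!mulrA (mulrC n%:R).
apply: (ler_wpM2l (ler0n _ s)); apply: (ler_wpM2r (ler0n _ n)).
exact: (ler_wpM2l (ler0n _ L)).
Qed.

(** * Uniform bounds and the exponent *)

(** The exponent 2 d^2 + d - 1/2 exceeds (d + 1)^2 by at least 1/2, which leaves
    room for the constant c < sqrt H. *)
Lemma lt_of_root_bound (R : realType) (d H p c : nat) :
    (2 <= d)%N -> (c ^ 2 < H)%N ->
    H%:R <= (p%:R : R) `^ (1 / (2 * d%:R ^+ 2 + d%:R - 1 / 2)) ->
  (c * H ^ (d.+1 ^ 2) < p)%N.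
Proof.
move=> d2 cH; set theta := (2 * _ + _ - _) => Hp.
have d2' : 2 <= d%:R :> R by rewrite ler_nat.
have theta_le : 1 / 2 + (d.+1 ^ 2)%:R <= theta.
  rewrite natrX -(natr1 d) /theta.
  have : 0 <= (d%:R - 2) * (d%:R + 1) :> R by rewrite mulr_ge0 //; lra.
  lra.
have theta0 : 0 < theta by apply: lt_le_trans theta_le; rewrite ltr_wpDr ?ler0n.
have H1 : 1 <= H%:R :> R by rewrite ler1n; apply: leq_ltn_trans cH.
have H0 : 0 <= H%:R :> R by rewrite ler0n.
have Htheta : H%:R `^ theta <= p%:R.
  have := @ge0_ler_powR _ theta (ltW theta0) H%:R _ _ _ Hp.
  rewrite -powRrM div1r mulVf ?gt_eqF // powRr1 //; apply.
    by rewrite nnegrE.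
  by rewrite nnegrE powR_ge0.
rewrite -(ltr_nat R); apply: lt_le_trans Htheta.
apply: lt_le_trans (ler_powR H1 theta_le).
rewrite powRD; last by rewrite (gt_eqF (lt_le_trans ltr01 H1)) implybT.
rewrite (natrM _ c) (natrX _ H) powR_mulrn //.
rewrite ltr_pM2r ?exprn_gt0 ?(lt_le_trans ltr01 H1) //.
have -> : c%:R = ((c ^ 2)%:R : R) `^ (1 / 2).
  by rewrite natrX -powR_mulrn // -powRrM (_ : 2%:R * (1 / 2) = 1) ?powRr1 //; field.
by apply: gt0_ltr_powR; rewrite ?nnegrE ?ler0n ?ltr_nat.
Qed.

(** For H at most the square of the constant in the lift, the trivial bound
    H + 1 is absorbed in C. *)
Lemma card_rimage_interval_le (R : realType) (d : nat) (eps : R) :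
    (2 <= d)%N -> 0 < eps ->
  exists C : R, 0 <= C /\
    forall (p : nat) (psi : {fraction {poly 'F_p}}) (H : nat) (K L : int),
      prime p -> rdeg psi = d -> (0 < H)%N ->
      H%:R <= (p%:R : R) `^ (1 / (2 * d%:R ^+ 2 + d%:R - 1 / 2)) ->
      #|rimage psi (interval_mod p K H) :&: interval_mod p L H|%:R
        <= C * H%:R `^ (d%:R^-1 + eps).
Proof.
move=> d2 e0; have d0 := ltnW d2.
pose c := (2 * d.+1)`!; pose K0 := (d.+1 * c)%N.
pose C0 := (d.+1 * (2 * d.+1) + d)%N.
have K00 : (0 < K0)%N by rewrite muln_gt0 fact_gt0.
have [m [s par]] := parameters C0 d2 K00 e0.
have [ell [ellI ellP]] := prime_sequence.
pose L := (\max_(j < s) ell j).+1.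
have [C [C_ge0 CP]] := par L isT.
exists (C + (c ^ 2).+1%:R); split; first by rewrite addr_ge0.
move=> p psi H K L' pP psid H0 Hp.
have pow1 : 1 <= (H%:R : R) `^ (d%:R^-1 + eps).
  rewrite -[leLHS](powRr0 (H%:R : R)) ler_powR ?ler1n // addr_ge0 ?ltW //.
  by rewrite invr_gt0 ltr0n.
have [F [G [A [b [[co sFG GN0] [bH eF cardA]]]]]] :=
  rimage_interval_points H K L' d0 psid.
have [Hc|cH] := leqP H (c ^ 2).
  apply: (@le_trans _ _ (c ^ 2).+1%:R).
    rewrite ler_nat (leq_trans cardA) // (leq_trans (max_card _)) //.
    by rewrite card_ord.
  by rewrite -[leLHS]mulr1 ler_pM // lerDr.
have [X [Y [X1 Y1 Ys Xn le]]] := CP H H0.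
apply: (@le_trans _ _ (d + s * (L * X * (m.+1 * d)))%:R); last first.
  by apply: le_trans le _; rewrite ler_wpM2r ?powR_ge0 // lerDl.
rewrite ler_nat (leq_trans cardA) //.
apply: (@card_points d m s p H X Y L (fun j : 'I_s => ell j) F G A b) => //.
- exact: lt_of_root_bound d2 cH Hp.
- by move=> i j /ellI /val_inj.
- by move=> j; rewrite /L ltnW // ltnS (leq_bigmax (F := fun j : 'I_s => ell j)).
- have HC0 : (H ^ C0 = (H ^ d.+1) ^ (2 * d.+1) * H ^ d)%N.
    by rewrite /C0 expnD expnM.
  by apply: leq_ltn_trans Ys; rewrite HC0 /kernel_bound -/c /K0 !mulnA.
Qed.

Local Open Scope classical_set_scope.
Local Open Scope ring_scope.

(** The exponent is read off from the largest k with Q n k, which exists by the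
    trivial bound (and is replaced by 1 if it is 0 or Q n is empty, so that its
    logarithm makes sense).  The bound with eps / 2 shows that this logarithm
    is at most a constant plus (a + eps / 2) ln n, and the constant is
    negligible against ln n. *)
Lemma exponent_sequence (R : realType) (a : R) (Q : nat -> nat -> Prop) :
    0 <= a -> (forall n k, Q n k -> (k <= n.+1)%N) ->
    (forall eps : R, 0 < eps -> exists C : R, 0 <= C /\
      forall n k, (0 < n)%N -> Q n k -> k%:R <= C * n%:R `^ (a + eps)) ->
  exists e : nat -> R, e n @[n --> \oo] --> (0 : R) /\
    forall n k, (1 < n)%N -> Q n k -> k%:R <= n%:R `^ (a + e n).
Proof.
move=> a0 Qn Qeps.
pose N n := maxn 1 (\max_(k < n.+2 | `[< Q n k >]) k).
have N1 n : 1 <= (N n)%:R :> R by rewrite ler1n leq_maxl.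
pose e n : R := Num.max 0 (ln (N n)%:R / ln n%:R - a).
exists e; split; last first.
  move=> n k n1 Qk; have ln0 : 0 < ln (n%:R : R) by rewrite ln_gt0 // ltr1n.
  have kn : (k < n.+2)%N by rewrite ltnS Qn.
  apply: (@le_trans _ _ (N n)%:R).
    rewrite ler_nat leq_max; apply/orP; right.
    apply: (leq_bigmax_cond (F := fun k : 'I_n.+2 => k : nat) (Ordinal kn)).
    exact/asboolP.
  have Npos : 0 < (N n)%:R :> R by apply: lt_le_trans (N1 n).
  rewrite -[leLHS]lnK ?posrE // /powR gt_eqF ?ltr0n ?(ltnW n1) //.
  rewrite ler_expR -ler_pdivrMr // -lerBlDl /e le_max lexx orbT //.
apply/cvgrPdist_lt => eps eps0.
have eps20 : 0 < eps / 2 by rewrite divr_gt0.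
have [C [C_ge0 CP]] := Qeps _ eps20.
pose B := C + 1.
have B1 : 1 <= B by rewrite lerDr.
have B0 : 0 < B by apply: lt_le_trans B1.
have Nle n : (0 < n)%N -> (N n)%:R <= B * n%:R `^ (a + eps / 2).
  move=> n0.
  have p1 : 1 <= (n%:R : R) `^ (a + eps / 2).
    by rewrite -[leLHS](powRr0 (n%:R : R)) ler_powR ?ler1n // addr_ge0 // ltW.
  have max_le i j (r : R) : i%:R <= r -> j%:R <= r -> (maxn i j)%:R <= r.
    by rewrite /maxn; case: ifP.
  apply: (max_le _ _ _); first by rewrite mulr_ege1.
  apply: (big_ind (fun k => k%:R <= _)); first 1 last.
  - by move=> i j; apply: max_le.
  - move=> k /asboolP Qk; apply: le_trans (CP n k n0 Qk) _.
    by rewrite ler_wpM2r ?powR_ge0 // lerDl.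
  by rewrite mulr_ge0 ?powR_ge0 // ltW.
near=> n.
have nlarge : expR (2 * ln B / eps + 1) <= n%:R.
  by near: n; exact: nbhs_infty_ger.
have lnB : 0 <= ln B by rewrite ln_ge0.
have t0 : 0 <= 2 * ln B / eps by rewrite divr_ge0 ?mulr_ge0 // ltW.
have n0' : 0 < n%:R :> R by apply: lt_le_trans nlarge; exact: expR_gt0.
have n0 : (0 < n)%N by rewrite -(ltr0n R).
have lnn : 2 * ln B / eps + 1 <= ln n%:R.
  by rewrite -(expRK (_ + 1)) ler_ln ?posrE ?expR_gt0.
have ln0 : 0 < ln (n%:R : R) by apply: lt_le_trans lnn; rewrite ltr_wpDl.
rewrite sub0r normrN ger0_norm ?le_max ?lexx //.
rewrite /e gt_max eps0 /=.
rewrite ltrBlDr ltr_pdivrMr //.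
have Npos : 0 < (N n)%:R :> R by apply: lt_le_trans (N1 n).
have : ln (N n)%:R <= ln B + (a + eps / 2) * ln n%:R.
  rewrite -ln_powR -lnM ?posrE ?powR_gt0 //.
  by rewrite ler_ln ?posrE ?mulr_gt0 ?powR_gt0 ?Nle.
move/le_lt_trans; apply.
have : 2 * ln B / eps < ln n%:R by apply: lt_le_trans lnn; rewrite ltrDl.
rewrite ltr_pdivrMr // => lt2.
lra.
Unshelve. all: by end_near.
Qed.

(* H = 1 is left out because 1 `^ t = 1 for every exponent t. *)
Theorem corollary1p2 (R : realType) (d : nat) (hd : (2 <= d)%N) :
  exists e : nat -> R, e n @[n --> \oo] --> (0 : R) /\
    forall (p : nat) (psi : {fraction {poly 'F_p}}) (H : nat) (K L : int),
      prime p -> rdeg psi = d -> (1 < H)%N ->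
      (H%:R : R) <= p%:R `^ (1 / (2 * d%:R ^+ 2 + d%:R - 1 / 2)) ->
      (#|rimage psi (interval_mod p K H) :&: interval_mod p L H|%:R : R)
        <= H%:R `^ (1 / d%:R + e H).
Proof.
pose Q H k := exists (p : nat) (psi : {fraction {poly 'F_p}}) (K L : int),
  [/\ prime p, rdeg psi = d,
    (H%:R : R) <= p%:R `^ (1 / (2 * d%:R ^+ 2 + d%:R - 1 / 2))
    & k = #|rimage psi (interval_mod p K H) :&: interval_mod p L H|].
have [||eps eps0|e [e0 eQ]] := @exponent_sequence R d%:R^-1 Q.
- by rewrite invr_ge0.
- move=> H _ [p [psi [K [L [_ _ _ ->]]]]].
  apply: leq_trans (subset_leq_card (finset.subsetIr _ _)) _.
  by apply: leq_trans (leq_imset_card _ _) _; rewrite card_ord.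
- have [C [C_ge0 CP]] := card_rimage_interval_le hd eps0.
  exists C; split=> // H _ H0 [p [psi [K [L [pP psid Hp ->]]]]].
  exact: CP.
exists e; split=> // p psi H K L pP psid H1 Hp; rewrite div1r.
by apply: eQ => //; exists p, psi, K, L.
Qed.
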